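(* Let $p>-1$ be non-zero and let $C\in\mathcal{K}_{(0)}(\mathbb{C})$. Then there exists $d_{C,p}>0$ such that $$\mathrm{I}_{C,p}K=d_{C,p}\,\mathrm{I}_pK$$ for every $\mathbb{S}^1$-invariant $K\in\mathcal{S}_0(\mathbb{C}^n)$.
   Context: Identify $\mathbb{C}^n\cong\mathbb{R}^{2n}$ with Euclidean inner product $\langle\cdot,\cdot\rangle$ and unit sphere $\mathbb{S}^{2n-1}$; $\mathbb{S}^1\subseteq\mathbb{C}$ is the unit circle. $\mathcal{S}_0(\mathbb{C}^n)=\mathcal{S}_0(\mathbb{R}^{2n})$ is the set of star bodies: compact sets, star-shaped with respect to the origin, whose radial function $\rho_K(u)=\sup\{\lambda\ge0:\lambda u\in K\}$, $u\neq0$, is positive and continuous. $K$ is $\mathbb{S}^1$-invariant if $cK=K$ for all $c\in\mathbb{S}^1$. $\mathcal{K}_{(0)}(\mathbb{C})$ is the set of compact convex subsets of $\mathbb{C}\cong\mathbb{R}^2$ containing the origin in their interior. For $C\in\mathcal{K}_{(0)}(\mathbb{C})$ and $p>-2$ non-zero, the complex $L_p$-intersection body $\mathrm{I}_{C,p}K$ of $K\in\mathcal{S}_0(\mathbb{C}^n)$ is the star body with radial function $\rho_{\mathrm{I}_{C,p}K}(u)^{-p}=\int_K h_{Cu}(x)^p\,dx$, $u\in\mathbb{S}^{2n-1}$, where $Cu=\{cu:c\in C\}$ and $h_L(x)=\sup\{\langle x,y\rangle:y\in L\}$. For $p>-1$ non-zero, the (real) $L_p$-intersection body $\mathrm{I}_pK$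 is the star body with radial function $\rho_{\mathrm{I}_pK}(u)^{-p}=\int_K|\langle x,u\rangle|^p\,dx$. *)

(* Defs.v *)
From HB Require Import structures.
From mathcomp Require Import all_boot all_order all_algebra.
From mathcomp Require Import complex.
From mathcomp Require Import all_classical all_reals all_analysis.

Set Implicit Arguments.
Unset Strict Implicit.
Unset Printing Implicit Defensive.

Import Order.TTheory GRing.Theory Num.Theory.
Import numFieldNormedType.Exports.

Local Open Scope classical_set_scope.
Local Open Scope ring_scope.
Local Open Scope complex_scope.

(* An alias of mu \x nu that carries its sigma-finite measure structure: on
   product_measure1 itself, canonical inference only finds the instance for
   subprobabilities. *)
Section sigma_finite_product.
Context d1 d2 (T1 : measurableType d1) (T2 : measurableType d2) (R : realType).
Variables (mu : {sigma_finite_measure set T1 -> \bar R}).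
Variables (nu : {sigma_finite_measure set T2 -> \bar R}).

Definition sf_product : set (T1 * T2) -> \bar R := (mu \x nu)%E.

HB.instance Definition _ := Measure.on sf_product.

Let sf_product_sigma_finite : sigma_finite setT sf_product.
Proof.
have /sigma_finiteP[F [TF ndF Foo]] := sigma_finiteT mu.
have /sigma_finiteP[G [TG ndG Goo]] := sigma_finiteT nu.
exists (fun n => F n `*` G n).
  rewrite -setXTT TF TG predeqE => -[x y]; split.
    move=> [/= [n _ Fnx] [k _ Gky]]; exists (maxn n k) => //; split.
    - by move: x Fnx; exact/subsetPset/ndF/leq_maxl.
    - by move: y Gky; exact/subsetPset/ndG/leq_maxr.
  by move=> [n _ []/= ? ?]; split; exists n.
move=> k; have [? ?] := Foo k; have [? ?] := Goo k.
split; first exact: measurableX.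
by rewrite /sf_product product_measure1E// lte_mul_pinfty// ge0_fin_numE.
Qed.

HB.instance Definition _ := Measure_isSigmaFinite.Build _ _ _ sf_product
  sf_product_sigma_finite.

End sigma_finite_product.

Section tuple_measure.
Context d (T : measurableType d) (R : realType).
Variable mu : {sigma_finite_measure set T -> \bar R}.

Definition tuple_cons n (xt : T * n.-tuple T) : n.+1.-tuple T :=
  [the n.+1.-tuple T of xt.1 :: xt.2].

Lemma measurable_tuple_cons n : measurable_fun setT (@tuple_cons n).
Proof. exact: measurable_cons. Qed.

Definition cons_measure n
    (nu : {sigma_finite_measure set (n.-tuple T) -> \bar R}) :
  set (n.+1.-tuple T) -> \bar R :=
  pushforward (sf_product mu nu) (@tuple_cons n).

Section cons_measure_instances.
Variables (n : nat) (nu : {sigma_finite_measure set (n.-tuple T) -> \bar R}).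

Let cons_measure0 : cons_measure nu set0 = 0%E.
Proof. by rewrite /cons_measure /pushforward preimage_set0 measure0. Qed.

Let cons_measure_ge0 A : (0 <= cons_measure nu A)%E.
Proof. by rewrite /cons_measure /pushforward; apply: measure_ge0. Qed.

Let cons_measure_sigma_additive : semi_sigma_additive (cons_measure nu).
Proof.
pose m : {measure set _ -> \bar R} :=
  measure_function_pushforward__canonical__measure_function_Measure
    (sf_product mu nu) (@measurable_tuple_cons n).
exact: (@measure_semi_sigma_additive _ _ _ m).
Qed.

HB.instance Definition _ := isMeasure.Build _ _ _ (cons_measure nu)
  cons_measure0 cons_measure_ge0 cons_measure_sigma_additive.

Let cons_measure_sigma_finite : sigma_finite setT (cons_measure nu).
Proof.
have [F FT Foo] := sigma_finiteT (sf_product mu nu).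
have mu1 : measurable_fun setT
    (fun t : n.+1.-tuple T => (thead t, [tuple of behead t])).
  apply/measurable_fun_pairP; split; last exact: measurable_behead.
  exact: measurable_tnth.
have consK : cancel (@tuple_cons n) (fun t => (thead t, [tuple of behead t])).
  by move=> [x t]; congr pair; apply: val_inj.
exists (fun k =>
  (fun t : n.+1.-tuple T => (thead t, [tuple of behead t])) @^-1` F k).
  by rewrite -preimage_bigcup -FT preimage_setT.
move=> k; have [mF Fk] := Foo k; split.
  by rewrite -[X in measurable X]setTI; exact: mu1.
rewrite /cons_measure /pushforward -comp_preimage (_ : _ \o _ = id) ?preimage_id//.
by apply/funext => x; exact: consK.
Qed.

HB.instance Definition _ := Measure_isSigmaFinite.Build _ _ _ (cons_measure nu)
  cons_measure_sigma_finite.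

End cons_measure_instances.

(* The n-fold product measure mu x ... x mu; see tuple_measure_box. *)
Fixpoint tuple_measure n : {sigma_finite_measure set (n.-tuple T) -> \bar R} :=
  if n is n'.+1 then cons_measure (tuple_measure n') else dirac [tuple].


Lemma tuple_measure_box n (A : 'I_n -> set T) :
  (forall i, measurable (A i)) ->
  tuple_measure n [set t | forall i, A i (tnth t i)] =
  (\big[*%E/1%E]_(i < n) mu (A i))%E.
Proof.
elim: n A => [A _|n IH A mA].
  by rewrite big_ord0 /= diracE mem_set// => -[].
have mbox m (B : 'I_m -> set T) : (forall i, measurable (B i)) ->
    measurable [set t : m.-tuple T | forall i, B i (tnth t i)].
  move=> mB.
  rewrite (_ : mkset _ = \bigcap_(i in setT) ((@tnth m T ^~ i) @^-1` B i)).
    apply: fin_bigcap_measurable => // i _; rewrite -[X in measurable X]setTI.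
    exact: measurable_tnth.
  by apply/seteqP; split => t /= h i; [move=> _; exact: h|exact: (h i I)].
rewrite big_ord_recl /= /cons_measure /pushforward.
rewrite (_ : _ @^-1` _ = A ord0 `*`
    [set t | forall i : 'I_n, A (lift ord0 i) (tnth t i)]).
  rewrite /sf_product product_measure1E//; last first.
    exact: (mbox _ (fun i => A (lift ord0 i))).
  by rewrite (IH (fun i => A (lift ord0 i))).
apply/seteqP; split => -[x t] /=.
  move=> h; split; first exact: (h ord0).
  by move=> i; have := h (lift ord0 i); rewrite tnthS.
move=> [h0 h] i; case: (unliftP ord0 i) => [j ->|->].
  by rewrite tnthS; exact: h.
exact: h0.
Qed.

End tuple_measure.

Section star_bodies.
Variable R : realType.

(* The field R[i] carries a topology through its regular module R[i]^o. *)
Definition Cspace n := 'rV[R[i]^o]_n.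

Definition lebesgueR2 :
  {sigma_finite_measure set (measurableTypeR R * measurableTypeR R)%type -> \bar R} :=
  sf_product (@lebesgue_measure R) (@lebesgue_measure R).

(* Lebesgue measure on C^n = (R * R)^n, in real coordinates. *)
Definition lebesgueC n :
  {sigma_finite_measure
    set (n.-tuple (measurableTypeR R * measurableTypeR R)%type) -> \bar R} :=
  tuple_measure lebesgueR2 n.

Definition of_coords n
  (t : n.-tuple (measurableTypeR R * measurableTypeR R)%type) : Cspace n :=
  \row_j ((tnth t j).1 +i* (tnth t j).2).

Definition integralC n (K : set (Cspace n)) (f : Cspace n -> R) : R :=
  (\int[lebesgueC n]_(t in @of_coords n @^-1` K) f (of_coords t))%R.

(* The Euclidean inner product of R^{2n}. *)
Definition dotR n (x y : Cspace n) : R :=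
  \sum_(j < n) 
    (complex.Re (x 0 j) * complex.Re (y 0 j) +
     complex.Im (x 0 j) * complex.Im (y 0 j)).

Definition unit_sphere n : set (Cspace n) := [set u | dotR u u = 1].

Definition dilate n (r : R) (K : set (Cspace n)) : set (Cspace n) :=
  [set r%:C *: x | x in K].

Definition radial n (K : set (Cspace n)) (u : Cspace n) : R :=
  sup [set l : R | 0 <= l /\ K (l%:C *: u)].

Definition star_shaped n (K : set (Cspace n)) : Prop :=
  forall x (t : R), K x -> 0 <= t <= 1 -> K (t%:C *: x).

Definition star_body n (K : set (Cspace n)) : Prop :=
  [/\ compact K, star_shaped K,
      forall u, u != 0 -> 0 < radial K u &
      {within [set u | u != 0], continuous (radial K)}].

Definition circle_invariant n (K : set (Cspace n)) : Prop :=
  forall c : R[i], `|c| = 1 -> [set c *: x | x in K] = K.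

(* Convexity is that of the real vector space Rcomplex R underlying R[i]. *)
Definition convex_body_0 (C : set R[i]^o) : Prop :=
  [/\ compact C,
      convex_set (C : set (convex_lmodType (Rcomplex R))) &
      interior C 0].

Definition support_fun n (L : set (Cspace n)) (x : Cspace n) : R :=
  sup [set dotR x y | y in L].

(* The body with prescribed radial function rho on the unit sphere; see
   radial_radial_body. *)
Definition radial_body n (rho : Cspace n -> R) : set (Cspace n) :=
  [set x | exists u l, [/\ unit_sphere u, 0 <= l <= rho u & x = l%:C *: u]].

(* The defining relation rho u `^ (- p) = integral, solved for rho u.
   For p < 0, powR gives 0 `^ p = 0 where the convention +oo would be natural;
   both integrands below vanish only on proper real subspaces, which are null. *)
Definition complex_intersection_body (C : set R[i]^o) (p : R) n
    (K : set (Cspace n)) : set (Cspace n) :=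
  radial_body (fun u =>
    integralC K (fun x => support_fun [set c *: u | c in C] x `^ p) `^ (- p^-1)).

Definition intersection_body (p : R) n (K : set (Cspace n)) : set (Cspace n) :=
  radial_body (fun u => integralC K (fun x => `|dotR x u| `^ p) `^ (- p^-1)).

Lemma dotR_scale n (r s : R) (x y : Cspace n) :
  dotR (r%:C *: x) (s%:C *: y) = r * s * dotR x y.
Proof.
rewrite /dotR mulr_sumr; apply: eq_bigr => j _; rewrite !mxE.
case: (x 0 j) => a b; case: (y 0 j) => c e /=.
by rewrite !mul0r !subr0 !addr0 mulrDr; congr (_ + _); rewrite mulrACA.
Qed.

Lemma radial_radial_body n (rho : Cspace n -> R) u :
  unit_sphere u -> 0 <= rho u -> radial (radial_body rho) u = rho u.
Proof.
move=> u1 rho0; rewrite /radial (_ : mkset _ = `[0, rho u]%classic).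
  by rewrite sup_itv.
apply/seteqP; split => l /=; rewrite in_itv /=; last first.
  by move=> /andP[l0 lr]; split => //; exists u, l; rewrite l0 lr.
move=> [l0 [v [m [v1 /andP[m0 mr] luv]]]]; rewrite l0 /=.
have ml : m = l.
  have : dotR (l%:C *: u) (l%:C *: u) = dotR (m%:C *: v) (m%:C *: v).
    by rewrite luv.
  rewrite !dotR_scale u1 v1 !mulr1 -!expr2 => /eqP.
  by rewrite eqrXn2// => /eqP.
have [l00|l00] := eqVneq l 0; first by rewrite l00.
move: luv mr; rewrite ml => /(congr1 (fun w => (l%:C)^-1 *: w)).
rewrite !scalerA mulVf ?scale1r; first by move=> ->.
by apply: contra l00 => /eqP/complexI ->.
Qed.

End star_bodies.

(* Main.v *)
(* Let z be the Hermitian product of x and u. Then h_{Cu}(x) = h_C(z)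
   and the real inner product of x and u is Re z, so both bodies are given by
   integrals over K of g(z) for a function g on the plane, nonnegative and
   positively homogeneous of degree p. Since K is invariant under the circle,
   the integral over K of g(c z) is |c|^p times that of g(z), and since an
   annulus A is invariant too, the integral over A of g(c z) dc is |z|^p times
   that of g. Integrating g(c z) over A x K in both orders (Tonelli) gives
     int_A |c|^p dc * int_K g(z) dx = int_A g dc * int_K |z|^p dx.
   As the integrals over A are positive and finite (here p > -1 is needed, for
   g = |Re|^p), the integrals over K for two such g have a ratio that depends
   on neither u nor K. *)
Require Import Defs.
From mathcomp Require Import all_boot all_order all_algebra.
From mathcomp Require Import complex ring lra.
From mathcomp Require Import all_classical all_reals all_analysis.
From mathcomp Require Import measurable_realfun.

Import Order.TTheory GRing.Theory Num.Theory.
Import numFieldNormedType.Exports.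

Set Implicit Arguments.
Unset Strict Implicit.
Unset Printing Implicit Defensive.

Local Open Scope classical_set_scope.
Local Open Scope ring_scope.
Local Open Scope complex_scope.

(** * Rotation invariance of Lebesgue measure *)

Section invariance.
Variable R : realType.
Local Notation R2 := (measurableTypeR R * measurableTypeR R)%type.
Local Notation lambda := (@lebesgue_measure R).

Definition shift (a : R) (x : measurableTypeR R) : measurableTypeR R :=
  (x : R) + a.

Lemma measurable_shift (a : R) :
  measurable_fun [set: measurableTypeR R] (shift a).
Proof. exact: measurable_funD. Qed.

(** Lebesgue measure is determined by its values on the intervals []x, y]], and the preimage of such
    an interval under a translation has the same length. *)
Lemma lebesgue_measure_shift (a : R) (A : set (measurableTypeR R)) :
  measurable A -> pushforward lambda (shift a) A = lambda A.
Proof.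
move=> mA; apply/esym.
pose m : {measure set _ -> \bar R} :=
  measure_function_pushforward__canonical__measure_function_Measure
    lambda (measurable_shift a).
apply: (@lebesgue_measure_unique _ m) => //= _ [[x y]] _ <-.
rewrite /m /= /pushforward (_ : _ @^-1` _ = `]x - a, y - a]%classic); last first.
  by apply/seteqP; split => z /=; rewrite !in_itv/= ltrBlDr lerBrDr.
rewrite !lebesgue_measure_itv/= !lte_fin ltrD2r -!EFinB.
by case: ifP => // _; congr EFin; ring.
Qed.

Lemma ge0_integral_shift (a : R) (f : measurableTypeR R -> \bar R) :
  measurable_fun setT f -> (forall x, 0 <= f x)%E ->
  (\int[lambda]_x f (shift a x) = \int[lambda]_x f x)%E.
Proof.
move=> mf f0.
transitivity (\int[pushforward lambda (shift a)]_x f x)%E.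
  by rewrite (ge0_integral_pushforward (measurable_shift a))// ?preimage_setT.
apply: eq_measure_integral => [|mS A mA _]; first exact: measurable_shift.
exact: lebesgue_measure_shift.
Qed.

(** Invariance is expressed through integrals of nonnegative functions, not measures of sets: in
    this form Tonelli reduces it to one variable at a time. *)
Definition preserves d (T : measurableType d) (mu : {measure set T -> \bar R})
    (phi : T -> T) :=
  measurable_fun setT phi /\
  forall f : T -> \bar R, measurable_fun setT f -> (forall x, 0 <= f x)%E ->
    (\int[mu]_x f (phi x) = \int[mu]_x f x)%E.

Lemma preserves_comp d (T : measurableType d) (mu : {measure set T -> \bar R})
    (phi psi : T -> T) :
  preserves mu phi -> preserves mu psi -> preserves mu (phi \o psi).
Proof.
move=> [mphi Hphi] [mpsi Hpsi]; split; first exact: measurableT_comp.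
move=> f mf f0; rewrite -(Hphi f)//; apply: (Hpsi (f \o phi)) => [|x /=] //.
exact: measurableT_comp.
Qed.

Definition shear1 (s : R) (z : R2) : R2 := (z.1 + s * z.2, z.2).
Definition shear2 (s : R) (z : R2) : R2 := (z.1, z.2 + s * z.1).

Lemma measurable_shear1 s : measurable_fun setT (shear1 s).
Proof.
apply/measurable_fun_pairP; split => //=.
  by apply: measurable_funD => //; apply: measurable_funM.
exact: measurable_snd.
Qed.

Lemma measurable_shear2 s : measurable_fun setT (shear2 s).
Proof.
apply/measurable_fun_pairP; split => //=.
  exact: measurable_fst.
by apply: measurable_funD => //; apply: measurable_funM.
Qed.

(** Tonelli with the sheared coordinate innermost: for fixed [y] the shear is the translation by
    [s * y]. *)
Lemma preserves_shear1 s : preserves (lebesgueR2 R) (shear1 s).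
Proof.
have ms := measurable_shear1 s.
split=> // f mf f0; rewrite /lebesgueR2 /sf_product.
rewrite (fubini_tonelli2 (f \o shear1 s)); [|exact: measurableT_comp|by move=> z /=].
rewrite [RHS](fubini_tonelli2 f mf f0).
apply: eq_integral => y _.
rewrite /fubini_G/= -(@ge0_integral_shift (s * y) (fun x => f (x, y)))//.
exact: (measurableT_comp mf (pair2_measurable y)).
Qed.

Lemma preserves_shear2 s : preserves (lebesgueR2 R) (shear2 s).
Proof.
have ms := measurable_shear2 s.
split=> // f mf f0; rewrite /lebesgueR2 /sf_product.
rewrite (fubini_tonelli1 (f \o shear2 s)); [|exact: measurableT_comp|by move=> z /=].
rewrite [RHS](fubini_tonelli1 f mf f0).
apply: eq_integral => x _.
rewrite /fubini_F/= -(@ge0_integral_shift (s * x) (fun y => f (x, y)))//.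
exact: (measurableT_comp mf (pair1_measurable x)).
Qed.

Definition cmul (c z : R2) : R2 :=
  (c.1 * z.1 - c.2 * z.2, c.1 * z.2 + c.2 * z.1).
Definition sqnorm (c : R2) : R := c.1 ^+ 2 + c.2 ^+ 2.

Lemma cmulC c z : cmul c z = cmul z c.
Proof. by rewrite /cmul; congr pair; ring. Qed.

Lemma sqnormM c z : sqnorm (cmul c z) = sqnorm c * sqnorm z.
Proof. by rewrite /sqnorm/=; ring. Qed.

(* A rotation by an angle t <> pi is a product of three shears, of slopes
   - tan (t / 2), sin t and - tan (t / 2). *)
Lemma preserves_rotation (c : R2) : sqnorm c = 1 ->
  preserves (lebesgueR2 R) (cmul c).
Proof.
move=> c1.
have main (a : R2) : sqnorm a = 1 -> 1 + a.1 != 0 ->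
    preserves (lebesgueR2 R) (cmul a).
  move=> a1 a0.
  have [s sE] : exists s, s * (1 + a.1) = - a.2.
    by exists (- (a.2 / (1 + a.1))); rewrite mulNr divfK.
  rewrite (_ : cmul a = shear1 s \o shear2 a.2 \o shear1 s).
    by do 2?[apply: preserves_comp]; first [exact: preserves_shear1|exact: preserves_shear2].
  case: a a1 a0 sE => a b; rewrite /sqnorm/= => a1 a0 sE.
  (* The product of the three shears has diagonal entries [1 + b * s], lower left entry [b] and
     upper right entry [s * (2 + b * s)]. The equations [bs] and [e2] identify these with the
     entries [a], [b] and [- b] of the rotation. *)
  have bs : b * s = a - 1.
    apply: (mulIf a0); rewrite -mulrA sE mulrN -expr2.
    rewrite (_ : b ^+ 2 = 1 - a ^+ 2); [ring|rewrite -a1; ring].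
  apply/funext => -[x y]; rewrite /cmul /shear1 /shear2 /=.
  have e2 : s * (1 + (1 + b * s)) = - b by rewrite bs -sE; congr (s * _); ring.
  congr pair.
    rewrite [RHS](_ : _ = x * (1 + b * s) + s * (1 + (1 + b * s)) * y); last ring.
    by rewrite e2 bs; ring.
  rewrite [RHS](_ : _ = y * (1 + b * s) + b * x); last ring.
  by rewrite bs; ring.
(* The excluded rotation, by pi, is the square of the quarter turn [(0, 1)]. *)
have [cN1|] := eqVneq (1 + c.1) 0; last exact: main.
rewrite (_ : cmul c = cmul (0, 1) \o cmul (0, 1)).
  by apply: preserves_comp; apply: main; rewrite /sqnorm/= ?addr0 ?oner_eq0//; ring.
have c1E : c.1 = -1 by lra.
have c2E : c.2 = 0.
  move: c1; rewrite /sqnorm c1E sqrrN expr1n => h.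
  by apply/eqP; rewrite -sqrf_eq0; apply/eqP; lra.
by apply/funext => z; rewrite /cmul /= c1E c2E; congr pair; ring.
Qed.

(** Induction on [n]: Tonelli splits off the head of the tuple, the hypothesis on [phi] transforms
    the head, and the induction hypothesis transforms the tail with the head held fixed. *)
Lemma preserves_tuple d (T : measurableType d)
    (mu : {sigma_finite_measure set T -> \bar R}) (phi : T -> T) n :
  preserves mu phi ->
  preserves (tuple_measure mu n) (map_tuple phi : n.-tuple T -> n.-tuple T).
Proof.
move=> [mphi Hphi].
have mmap k : measurable_fun setT (map_tuple phi : k.-tuple T -> k.-tuple T).
  apply/measurable_fun_tnthP => i.
  rewrite (_ : _ \o _ = phi \o (@tnth _ T ^~ i)); last first.
    by apply/funext => t /=; rewrite tnth_map.
  by apply: measurableT_comp => //; exact: measurable_tnth.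
split; first exact: mmap.
elim: n => [|n IH] f mf f0.
  by apply: eq_integral => t _; rewrite tuple0 [in RHS]tuple0.
have mcons := measurable_tuple_cons (T:=T) (n:=n).
pose f' := f \o map_tuple phi.
have mf' : measurable_fun setT f' by exact: measurableT_comp (mmap _).
have f'0 t : (0 <= f' t)%E by exact: f0.
have tonelli (h : n.+1.-tuple T -> \bar R) : measurable_fun setT h ->
    (forall t, 0 <= h t)%E ->
    (\int[tuple_measure mu n.+1]_t h t =
     \int[mu]_x \int[tuple_measure mu n]_t h (tuple_cons (x, t)))%E.
  move=> mh h0; rewrite /= /cons_measure.
  rewrite (ge0_integral_pushforward mcons) ?preimage_setT//.
  exact: (fubini_tonelli1 (h \o @tuple_cons _ _ _)
    (measurableT_comp mh mcons) (fun _ => h0 _)).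
rewrite (tonelli f mf f0) (tonelli f' mf' f'0).
have mF := measurable_fun_fubini_tonelli_F (m2 := tuple_measure mu n)
  (f \o @tuple_cons _ _ _) (measurableT_comp mf mcons) (fun _ => f0 _).
rewrite -[RHS](Hphi _ mF) => [|x]; last by apply: integral_ge0 => y _; exact: f0.
apply: eq_integral => x _.
rewrite /fubini_F /= -(IH (fun t => f (tuple_cons (phi x, t)))) //.
  by apply: eq_integral => t _; rewrite /f' /=; congr f; apply: val_inj.
apply: (measurableT_comp mf); apply: (measurableT_comp mcons).
exact: pair1_measurable.
Qed.

End invariance.

(** * Borel sets of C^n in real coordinates *)

Section open_measurable.
Variable R : realType.
Local Notation R2 := (measurableTypeR R * measurableTypeR R)%type.

Definition close_to (e : R) (z w : R2) : Prop :=
  `|w.1 - z.1 : R| < e /\ `|w.2 - z.2 : R| < e.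

Lemma sqrt_sqrD_le (a b : R) : Num.sqrt (a ^+ 2 + b ^+ 2) <= `|a| + `|b|.
Proof.
rewrite -[leRHS]ger0_norm ?addr_ge0// -sqrtr_sqr ler_sqrt ?sqr_ge0//.
rewrite -[a ^+ 2]real_normK ?num_real// -[b ^+ 2]real_normK ?num_real//.
by rewrite sqrrD addrAC lerDl mulrn_wge0// mulr_ge0.
Qed.

Lemma measurable_close_to e z : measurable [set w : R2 | close_to e z w].
Proof.
have mI (f : R2 -> measurableTypeR R) (a : R) : measurable_fun setT f ->
    measurable [set w | `|f w - a : R| < e].
  move=> mf; rewrite (_ : mkset _ = f @^-1` `]a - e, a + e[%classic).
    by rewrite -[X in measurable X]setTI; exact: mf.
  by apply/seteqP; split => w /=; rewrite in_itv/= ltr_distl.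
by apply: measurableI; apply: mI.
Qed.

(* [P] is a union of boxes with rational centers and radii [1 / m], of which
   there are countably many. *)
Lemma measurable_tuple_open n (P : set (n.-tuple R2)) :
  (forall t, P t -> exists2 e : R, 0 < e &
    forall s, (forall i, close_to e (tnth t i) (tnth s i)) -> P s) ->
  measurable P.
Proof.
move=> oP.
pose ctr (q : rat * rat) : R2 := (ratr q.1, ratr q.2).
pose box (q : n.-tuple (rat * rat)%type * nat) : set (n.-tuple R2) :=
  [set s | forall i, close_to (q.2.+1%:R^-1) (ctr (tnth q.1 i)) (tnth s i)].
have mbox q : measurable (box q).
  rewrite (_ : box q = \bigcap_(i in setT)
      ((@tnth n R2 ^~ i) @^-1` [set w | close_to (q.2.+1%:R^-1) (ctr (tnth q.1 i)) w])).
    apply: fin_bigcap_measurable => // i _; rewrite -[X in measurable X]setTI.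
    by apply: measurable_tnth => //; exact: measurable_close_to.
  by apply/seteqP; split => t /= h i; [move=> _; exact: h|exact: (h i I)].
pose Q q := if pselect (box q `<=` P) then box q else set0.
rewrite (_ : P = \bigcup_q Q q).
  apply: countable_bigcupT_measurable => [|q]; first exact: countableP.
  rewrite /Q.
  by case: pselect => [?|?]; [exact: mbox|exact: measurable0].
apply/seteqP; split => [t Pt|t [q _]]; last first.
  by rewrite /Q; case: pselect => // h /h.
have [e e0 eP] := oP t Pt.
(* Two points of a box are compared through its center, so twice the radius has to stay below
   [e]. *)
have [m me] : exists m : nat, m.+1%:R^-1 + m.+1%:R^-1 < e.
  have e20 : 0 < e / 2 by rewrite divr_gt0.
  have [m _ mP] := near_infty_natSinv_lt (PosNum e20).
  have h : m.+1%:R^-1 < e / 2 := mP m (leqnn m).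
  by exists m; rewrite (splitr e) ltrD.
have m0 : 0 < m.+1%:R^-1 :> R by rewrite invr_gt0.
have approx (x : R) : exists q : rat, `|x - ratr q| < m.+1%:R^-1.
  have /rat_in_itvoo[q] : x - m.+1%:R^-1 < x + m.+1%:R^-1.
    by rewrite ltrBlDr -addrA ltrDl addr_gt0.
  by rewrite in_itv/= -ltr_distl distrC => qx; exists q.
pose q1 i := projT1 (cid (approx (tnth t i).1)).
pose q2 i := projT1 (cid (approx (tnth t i).2)).
have q1P i : `|(tnth t i).1 - ratr (q1 i)| < m.+1%:R^-1 := projT2 (cid (approx _)).
have q2P i : `|(tnth t i).2 - ratr (q2 i)| < m.+1%:R^-1 := projT2 (cid (approx _)).
pose q := ([tuple (q1 i, q2 i) | i < n], m).
have tq : box q t by move=> i; rewrite /= tnth_mktuple.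
exists q => //; rewrite /Q; case: pselect => // -[] s sq; apply: eP => i.
have {}tq := tq i; have {}sq := sq i.
case: tq sq; rewrite /q /= tnth_mktuple /= => t1 t2 [s1 s2].
split; apply: le_lt_trans me.
  by apply: le_trans (ler_distD (ratr (q1 i)) _ _) _; apply: lerD; rewrite ltW// distrC.
by apply: le_trans (ler_distD (ratr (q2 i)) _ _) _; apply: lerD; rewrite ltW// distrC.
Qed.

Lemma measurable_open2 (P : set R2) :
  (forall z, P z -> exists2 e : R, 0 < e & forall w, close_to e z w -> P w) ->
  measurable P.
Proof.
move=> oP.
have mP : measurable [set t : 1.-tuple R2 | P (tnth t ord0)].
  by apply: measurable_tuple_open => t /oP[e e0 eP]; exists e => // s /(_ ord0)/eP.
have m1 : measurable_fun setT (fun x : R2 => [tuple x]).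
  apply/measurable_fun_tnthP => i; rewrite (_ : _ \o _ = id)//.
  by apply/funext => x; rewrite /= ord1.
by have := m1 measurableT _ mP; rewrite setTI.
Qed.

Lemma measurable_of_coords n (K : set (Cspace R n)) :
  closed K -> measurable (@of_coords R n @^-1` K).
Proof.
move=> cK; rewrite -[X in measurable X]setCK; apply: measurableC.
apply: measurable_tuple_open => t /= Kt.
have : nbhs (of_coords t) (~` K) by apply: open_nbhs_nbhs; split => //; exact: closed_openC.
(* Radii of balls are elements of [R[i]]; a positive one has zero imaginary part. *)
move=> /nbhs_ballP[[e e'] /=]; rewrite ltcE/= => /andP[/eqP -> {e'} e0] eK.
(* The modulus of a complex number is at most the sum of the absolute values of its two parts, hence
   the half. *)
exists (e / 2); first by rewrite divr_gt0.
move=> s st; apply: eK; split; first by rewrite ltcR.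
move=> i j; rewrite !mxE -ball_normE /= normc_def ltcR /=.
have [h1 h2] := st j.
have st_e : `|(tnth s j).1 - (tnth t j).1| +
    `|(tnth s j).2 - (tnth t j).2| < e by rewrite (splitr e) ltrD.
apply: le_lt_trans st_e; rewrite (distrC (tnth s j).1) (distrC (tnth s j).2).
exact: sqrt_sqrD_le.
Qed.

End open_measurable.

(** * Averaging homogeneous functions over the circle *)

Section averaging.
Variable R : realType.
Local Notation R2 := (measurableTypeR R * measurableTypeR R)%type.

Definition modulus (z : R2) : R := Num.sqrt (sqnorm z).
Definition smul (r : R) (z : R2) : R2 := (r * z.1, r * z.2).

Lemma sqnorm_ge0 (z : R2) : 0 <= sqnorm z.
Proof. by rewrite addr_ge0// sqr_ge0. Qed.

Lemma smul_cmul r c z : cmul (smul r c) z = smul r (cmul c z).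
Proof. by rewrite /cmul /smul/=; congr pair; ring. Qed.

Lemma polar (z : R2) : exists2 w, sqnorm w = 1 & z = smul (modulus z) w.
Proof.
have [z0|z0] := eqVneq (modulus z) 0.
  exists (1, 0); first by rewrite /sqnorm/=; ring.
  have : sqnorm z = 0.
    by apply/eqP; move/eqP: z0; rewrite sqrtr_eq0 eq_le sqnorm_ge0 andbT.
  move/eqP; rewrite /sqnorm paddr_eq0 ?sqr_ge0// !sqrf_eq0 z0.
  by case: z {z0} => a b /= /andP[/eqP-> /eqP->]; rewrite /smul/= !mul0r.
exists (smul (modulus z)^-1 z).
  have : modulus z ^+ 2 = sqnorm z by rewrite sqr_sqrtr// sqnorm_ge0.
  rewrite {1 2}/sqnorm /smul/= !exprMn -mulrDr => <-.
  by rewrite exprVn mulVf// expf_eq0 (negbTE z0) andbF.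
by case: z z0 => a b z0; rewrite /smul/= !mulrA divff// !mul1r.
Qed.

Lemma modulus_smul r z : 0 <= r -> modulus (smul r z) = r * modulus z.
Proof.
move=> r0; rewrite /modulus (_ : sqnorm _ = r ^+ 2 * sqnorm z).
  by rewrite sqrtrM ?sqr_ge0// sqrtr_sqr ger0_norm.
by rewrite /sqnorm/=; ring.
Qed.

Lemma measurable_modulus : measurable_fun setT modulus.
Proof.
apply: (@measurableT_comp _ _ _ _ _ _ (@Num.sqrt R)) => //.
  exact: (continuous_measurable_fun (@sqrt_continuous R)).
by apply: measurable_funD; apply: measurable_funX.
Qed.

Lemma measurable_fun_cmul d (T : measurableType d) (f g : T -> R2) :
  measurable_fun setT f -> measurable_fun setT g ->
  measurable_fun setT (fun x => cmul (f x) (g x)).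
Proof.
move=> /measurable_fun_pairP[f1 f2] /measurable_fun_pairP[g1 g2].
apply/measurable_fun_pairP; split.
  by apply: measurable_funB; apply: measurable_funM.
by apply: measurable_funD; apply: measurable_funM.
Qed.

Definition homogeneous (p : R) (g : R2 -> R) :=
  forall r z, 0 <= r -> g (smul r z) = r `^ p * g z.

(** The common setting of the two integrations: the annulus with [z] the identity, and [K] with [z]
    the Hermitian product with [u]. Rotating the value of [z] is realized by a measure-preserving
    map that fixes [A]. *)
Definition equivariant d (T : measurableType d)
    (mu : {measure set T -> \bar R}) (A : set T) (z : T -> R2) :=
  [/\ measurable A, measurable_fun setT z &
    forall w, sqnorm w = 1 -> exists2 phi, preserves mu phi &
      phi @^-1` A = A /\ forall x, z (phi x) = cmul w (z x)].

(** In the polar form of [c], the unit factor is absorbed by a measure-preserving map and the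
    modulus comes out by homogeneity. *)
Lemma integral_cmul d (T : measurableType d) (mu : {measure set T -> \bar R})
    (A : set T) (z : T -> R2) (p : R) (g : R2 -> R) c :
  equivariant mu A z -> measurable_fun setT g -> (forall w, 0 <= g w) ->
  homogeneous p g ->
  (\int[mu]_(x in A) (g (cmul c (z x)))%:E =
   (modulus c `^ p)%:E * \int[mu]_(x in A) (g (z x))%:E)%E.
Proof.
move=> [mA mz eqz] mg g0 hg; have [w w1 ->] := polar c.
have [phi [mphi phiP] [phiA phiz]] := eqz w w1.
have mgz : measurable_fun setT (fun x => (g (z x))%:E).
  by apply/measurable_EFinP; exact: measurableT_comp.
have -> : modulus (smul (modulus c) w) = modulus c.
  rewrite modulus_smul ?sqrtr_ge0//.
  by rewrite [modulus w]/modulus w1 sqrtr1 mulr1.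
under eq_integral do rewrite smul_cmul hg ?sqrtr_ge0// -phiz EFinM.
rewrite ge0_integralZl_EFin ?powR_ge0//; last 2 first.
- by move=> x _; rewrite lee_fin.
- by apply: measurable_funTS; exact: (measurableT_comp mgz).
(* Invariance concerns integrals over the whole space, so it is applied to the extension by zero
   from [A]; this is legitimate because [phi] pulls [A] back to itself. *)
congr (_ * _)%E; rewrite integral_mkcond [RHS]integral_mkcond -[RHS]phiP.
- apply: eq_integral => x _; rewrite !patchE.
  by rewrite -[in LHS]phiA.
- by apply/(measurable_restrictT _ mA); exact: measurable_funTS.
- by apply: erestrict_ge0 => x _; rewrite lee_fin.
Qed.

(* Both sides are the integral of [g (cmul (z1 x1) (z2 x2))] over [A1 `*` A2]. *)
Lemma integral_homogeneous_swap d1 d2 (T1 : measurableType d1)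
    (T2 : measurableType d2) (mu1 : {sigma_finite_measure set T1 -> \bar R})
    (mu2 : {sigma_finite_measure set T2 -> \bar R})
    A1 A2 (z1 : T1 -> R2) (z2 : T2 -> R2) (p : R) (g : R2 -> R) :
  equivariant mu1 A1 z1 -> equivariant mu2 A2 z2 ->
  measurable_fun setT g -> (forall w, 0 <= g w) -> homogeneous p g ->
  ((\int[mu1]_(x in A1) (modulus (z1 x) `^ p)%:E) *
     \int[mu2]_(x in A2) (g (z2 x))%:E =
   (\int[mu1]_(x in A1) (g (z1 x))%:E) *
     \int[mu2]_(x in A2) (modulus (z2 x) `^ p)%:E)%E.
Proof.
move=> e1 e2 mg g0 hg; have [mA1 mz1 _] := e1; have [mA2 mz2 _] := e2.
have mmod d (T : measurableType d) (D : set T) (z : T -> R2) : measurable_fun setT z ->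
    measurable_fun D (fun x => (modulus (z x) `^ p)%:E).
  move=> mz; apply: measurable_funTS; apply/measurable_EFinP.
  apply: (@measurableT_comp _ _ _ _ _ _ (@powR R ^~ p) _ (modulus \o z)).
    exact: measurable_powR.
  exact: (measurableT_comp measurable_modulus).
rewrite -ge0_integralZr//; last 3 first.
- exact: mmod.
- by move=> x _; rewrite lee_fin powR_ge0.
- by apply: integral_ge0 => x _; rewrite lee_fin.
rewrite -ge0_integralZl//; last 3 first.
- exact: mmod.
- by move=> x _; rewrite lee_fin powR_ge0.
- by apply: integral_ge0 => x _; rewrite lee_fin.
(* Read backwards, [integral_cmul] turns the two sides into the two iterated integrals. *)
under eq_integral do rewrite -(integral_cmul _ e2 mg g0 hg).
under [RHS]eq_integral do rewrite muleC -(integral_cmul _ e1 mg g0 hg).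
pose f (x : T1 * T2) := (g (cmul (z1 x.1) (z2 x.2)))%:E.
pose F := f \_ (A1 `*` A2).
have F0 x : (0 <= F x)%E by apply: erestrict_ge0 => y _; rewrite lee_fin.
have mF : measurable_fun setT F.
  apply/(measurable_restrictT _ (measurableX mA1 mA2)).
  apply: measurable_funTS; apply/measurable_EFinP; apply: (measurableT_comp mg).
  by apply: measurable_fun_cmul; [exact: (measurableT_comp mz1)|exact: (measurableT_comp mz2)].
rewrite integral_mkcond [RHS]integral_mkcond.
transitivity (\int[mu1]_x \int[mu2]_y F (x, y))%E.
  apply: eq_integral => x _; rewrite patchE; case: ifPn => xA.
    rewrite [LHS]integral_mkcond; apply: eq_integral => y _; rewrite /F !patchE.
    by rewrite in_setX /= xA.
  by apply/esym; apply: integral0_eq => y _; rewrite /F patchE in_setX /= (negbTE xA).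
rewrite (fubini_tonelli F mF F0); apply: eq_integral => y _; rewrite patchE; case: ifPn => yA.
  rewrite [RHS]integral_mkcond; apply: eq_integral => x _; rewrite /F !patchE.
  by rewrite in_setX /= yA andbT /f /= cmulC.
by apply: integral0_eq => x _; rewrite /F patchE in_setX /= (negbTE yA) andbF.
Qed.

End averaging.

(** * Integrability of powers *)

Section finiteness.
Variable R : realType.
Local Notation R2 := (measurableTypeR R * measurableTypeR R)%type.
Local Notation lambda := (@lebesgue_measure R).

Lemma integral_powR_pos (p a b : R) : -1 < p -> 0 < a -> a < b ->
  (\int[lambda]_(x in `[a, b]) (x `^ p)%:E =
   (b `^ (p + 1) / (p + 1))%:E - (a `^ (p + 1) / (p + 1))%:E)%E.
Proof.
move=> p1 a0 ab; have p0 : p + 1 != 0 by rewrite gt_eqF//; lra.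
have gt0 (x : R) : a <= x -> x \in `]0, +oo[.
  by move=> ax; rewrite in_itv/= andbT (lt_le_trans a0).
pose F (x : R) := x `^ (p + 1) / (p + 1).
have dF (x : R) : 0 < x -> is_derive x 1 F (x `^ p).
  move=> x0; have := @is_derive1_powR R (p + 1) x x0.
  rewrite addrK => dx.
  have -> : x `^ p = (p + 1)^-1 *: ((p + 1) * x `^ p).
    by rewrite /GRing.scale/= mulrA mulVf// mul1r.
  rewrite (_ : F = (p + 1)^-1 *: (@powR R ^~ (p + 1))); first exact: is_deriveZ.
  by apply/funext => y; rewrite /F mulrC.
have cF (x : R) : 0 < x -> {for x, continuous F}.
  by move=> /dF[dx _]; apply: differentiable_continuous; exact/derivable1_diffP.
rewrite (@continuous_FTC2 _ _ F)//.
- apply: derivable_within_continuous => x; rewrite in_itv/= => /andP[ax _].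
  by apply: derivable_powR; exact: gt0.
- split.
  + by move=> x; rewrite in_itv/= => /andP[ax _]; have [] := dF x (lt_trans a0 ax).
  + exact/cvg_at_right_filter/cF.
  + exact/cvg_at_left_filter/cF/(lt_trans a0).
- move=> x; rewrite in_itv/= => /andP[ax _].
  by rewrite derive1E; have [_ ->] := dF x (lt_trans a0 ax).
Qed.

Lemma measurable_norm_powR (p : R) (D : set (measurableTypeR R)) :
  measurable_fun D (fun x : measurableTypeR R => (`|x : R| `^ p)%:E).
Proof.
apply/measurable_EFinP; apply: measurable_funTS.
by apply: (@measurableT_comp _ _ _ _ _ _ (@powR R ^~ p) _ (@Num.norm R R)).
Qed.

Lemma integral_powR_lty (p b : R) : -1 < p -> 0 < b ->
  (\int[lambda]_(x in `[0%R, b]) (`|x| `^ p)%:E < +oo)%E.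
Proof.
move=> p1 b0.
rewrite -integral_itv_obnd_cbnd; last exact: measurable_norm_powR.
(* With [k.+2] the left endpoint is strictly below [b] from [k = 0] on, as [integral_powR_pos]
   requires. *)
pose F (k : nat) : set (measurableTypeR R) := `[b / k.+2%:R, b]%classic.
have -> : `]0%R, b]%classic = \bigcup_k F k.
  apply/seteqP; split => [x|x [k _]]; rewrite /F/= !in_itv/= => /andP[].
    move=> x0 xb; have xb0 : 0 < x / b by rewrite divr_gt0.
    have [m _ mP] := near_infty_natSinv_lt (PosNum xb0).
    have h : m.+2%:R^-1 < x / b := mP m.+1 (leqnSn m).
    exists m => //; rewrite /= in_itv/= xb andbT.
    by move: h; rewrite ltr_pdivlMr// mulrC => /ltW.
  by move=> + ->; rewrite andbT; apply: lt_le_trans; rewrite divr_gt0.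
have ndF : nondecreasing_seq F.
  move=> m n mn; rewrite subsetEset => x; rewrite /F /= !in_itv/= => /andP[+ ->].
  rewrite andbT; apply: le_trans; rewrite ler_pM2l// lef_pV2 ?posrE//.
  by rewrite ler_nat.
have mF k : measurable (F k) by exact: measurable_itv.
have := @ge0_nondecreasing_set_cvg_integral _ _ _ F (fun x => (`|x : R| `^ p)%:E) lambda
  ndF mF (fun i => @measurable_norm_powR p _) (fun i x _ => powR_ge0 _ _).
move=> /cvg_lim <-//.
apply: le_lt_trans (ltry (b `^ (p + 1) / (p + 1))).
apply: lime_le.
  apply: ereal_nondecreasing_is_cvgn.
  apply: ge0_nondecreasing_set_nondecreasing_integral => //.
  by move=> i; exact: measurable_norm_powR.
near=> k.
have bk : 0 < b / k.+2%:R by rewrite divr_gt0.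
rewrite /= (eq_integral (fun x : measurableTypeR R => ((x : R) `^ p)%:E)); last first.
  move=> x; rewrite inE /F/= in_itv/= => /andP[bx _].
  by rewrite ger0_norm// (le_trans _ bx)// ltW.
rewrite integral_powR_pos//; last first.
  by rewrite ltr_pdivrMr// ltr_pMr// ltr1n.
rewrite -EFinB lee_fin gerBl mulr_ge0 ?powR_ge0// invr_ge0; lra.
Unshelve. all: by end_near. Qed.

(** The integrand, extended by zero to [h], is even; the substitution of [- x] for [x] carries the
    negative half-line to the positive one. *)
Lemma integral_norm_powR_lty (p b : R) : -1 < p -> 0 < b ->
  (\int[lambda]_(x in `[(- b)%R, b]) (`|x| `^ p)%:E < +oo)%E.
Proof.
move=> p1 b0.
pose h := (fun x : R => (`|x| `^ p)%:E) \_ `[- b, b].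
have h0 x : (0 <= h x)%E by apply: erestrict_ge0 => y _; rewrite lee_fin powR_ge0.
have mh : measurable_fun [set: R] h.
  by apply/(measurable_restrictT _ (measurable_itv _)); exact: measurable_norm_powR.
have hN x : h (- x) = h x.
  rewrite /h !patchE normrN (_ : (- x \in _) = (x \in `[- b, b]%classic))//.
  by rewrite !mem_setE !in_itv/= lerN2 lerNl andbC.
have fin : (\int[lambda]_(x in `[0%R, +oo[) h x < +oo)%E.
  apply: le_lt_trans (integral_powR_lty p1 b0).
  rewrite integral_mkcond [leRHS]integral_mkcond; apply: ge0_le_integral => //.
  - by move=> x _; exact: erestrict_ge0.
  - by apply/(measurable_restrictT _ (measurable_itv _)); exact: measurable_funTS.
  - by apply/(measurable_restrictT _ (measurable_itv _)); exact: measurable_norm_powR.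
  - move=> x _; rewrite /h !patchE !mem_setE !in_itv/= andbT.
    have [x0|x0] := leP 0 x; last by [].
    have -> : (- b <= x)%R by apply: (le_trans _ x0); rewrite oppr_le0 ltW.
    by [].
rewrite integral_mkcond -/h.
have -> : [set: R] = `]-oo, 0[ `|` `[0, +oo[.
  by apply/seteqP; split => x //= _; rewrite !in_itv/= andbT; have [] := leP 0 x; [right|left].
rewrite ge0_integral_setU//=; last 2 first.
- exact: measurable_funTS.
- by apply/disj_set2P; apply/seteqP; split => x //=; rewrite !in_itv/= andbT leNgt => -[->].
rewrite integral_itv_bndo_bndc; last exact: measurable_funTS.
under eq_integral do rewrite -hN.
by rewrite -ge0_integration_by_substitution0// lte_add_pinfty.
Qed.

End finiteness.

(** * Integrals over an annulus *)

Section annulus.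
Variable R : realType.
Local Notation R2 := (measurableTypeR R * measurableTypeR R)%type.
Local Notation lambda := (@lebesgue_measure R).

(* The outer radius makes room for the rectangle of [rect_sub_annulus], on
   which the first coordinate is bounded away from [0]. *)
Definition annulus : set R2 := [set c | 1 <= sqnorm c <= 5].

Lemma measurable_sqnorm : measurable_fun setT (@sqnorm R).
Proof. by apply: measurable_funD; apply: measurable_funX. Qed.

Lemma measurable_annulus : measurable annulus.
Proof.
rewrite (_ : annulus = @sqnorm R @^-1` `[1, 5]%classic).
  by rewrite -[X in measurable X]setTI; exact: measurable_sqnorm.
by apply/seteqP; split => c /=; rewrite in_itv.
Qed.

Lemma equivariant_annulus : equivariant (lebesgueR2 R) annulus id.
Proof.
split; [exact: measurable_annulus|exact: measurable_id|move=> w w1].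
exists (cmul w); first exact: preserves_rotation.
by split => //; apply/seteqP; split => c; rewrite /annulus /= sqnormM w1 mul1r.
Qed.

Definition rect (a b c d : R) : set R2 := `[a, b]%classic `*` `[c, d]%classic.

Lemma measurable_rect a b c d : measurable (rect a b c d).
Proof. by apply: measurableX; exact: measurable_itv. Qed.

Lemma lebesgueR2_rect (a b c d : R) : a < b -> c < d ->
  lebesgueR2 R (rect a b c d) = ((b - a) * (d - c))%:E.
Proof.
move=> ab cd; transitivity (lambda `[a, b] * lambda `[c, d])%E.
  by apply: product_measure1E; exact: measurable_itv.
by rewrite !lebesgue_measure_itv/= !lte_fin ab cd EFinM !EFinB.
Qed.

Lemma annulus_sub : annulus `<=` rect (- 3) 3 (- 3) 3.
Proof.
move=> [a b]; rewrite /annulus /sqnorm /= => /andP[_ h].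
have sq (x : R) : x ^+ 2 <= 5 -> - (3:R) <= x <= 3.
  move=> x5; rewrite -ler_norml -(ler_pXn2r (n := 2)) ?nnegrE ?normr_ge0//.
  by rewrite real_normK ?num_real//; lra.
have a0 := sqr_ge0 a; have b0 := sqr_ge0 b.
by rewrite /rect/= !in_itv/=; split; apply: sq; lra.
Qed.

Lemma rect_sub_annulus : rect 1 2 0 1 `<=` annulus.
Proof.
move=> [a b]; rewrite /rect/= !in_itv/= => -[/andP[a1 a2] /andP[b0 b1]].
by rewrite /annulus /sqnorm /=; apply/andP; split; nra.
Qed.

(** The lower bound is asked for only where the first coordinate lies between 1 and 2, since the
    power of its absolute value takes the value 0 on the imaginary axis. *)
Lemma annulus_integral_gt0 (g : R2 -> R) (e : R) :
  measurable_fun setT g -> (forall z, 0 <= g z) -> 0 < e ->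
  (forall z : R2, 1 <= z.1 <= (2 : R) -> annulus z -> e <= g z) ->
  (0 < \int[lebesgueR2 R]_(c in annulus) (g c)%:E)%E.
Proof.
move=> mg g0 e0 eg.
have mgE (D : set R2) : measurable_fun D (fun c => (g c)%:E).
  by apply: measurable_funTS; exact/measurable_EFinP.
pose B := rect 1 2 0 1; have mB : measurable B := measurable_rect 1 2 0 1.
have : (0 < e%:E * lebesgueR2 R (rect 1 2 0 1))%E.
  rewrite /B lebesgueR2_rect ?ltr01//; last by rewrite ltr1n.
  by rewrite -EFinM lte_fin; nra.
move/lt_le_trans; apply; rewrite -integral_cst//.
apply: (@le_trans _ _ (\int[lebesgueR2 R]_(c in B) (g c)%:E)%E).
  apply: ge0_le_integral => //.
  - by move=> x _; rewrite lee_fin ltW.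
  - move=> z zB; rewrite lee_fin; apply: eg; last exact: rect_sub_annulus.
    by move: zB; rewrite /B /rect/= in_itv/= => -[].
apply: ge0_subset_integral => //; first exact: measurable_annulus.
- by move=> x _; rewrite lee_fin.
- exact: rect_sub_annulus.
Qed.

Lemma annulus_integral_lty (g : R2 -> R) (M : R) :
  measurable_fun setT g -> (forall z, 0 <= g z) ->
  (forall z : R2, annulus z -> g z <= M) ->
  (\int[lebesgueR2 R]_(c in annulus) (g c)%:E < +oo)%E.
Proof.
move=> mg g0 gM; have mA := measurable_annulus; pose B := rect (- 3) 3 (- 3) 3.
have M0 : 0 <= M.
  apply: (le_trans (g0 (1, 0))); apply: gM; rewrite /annulus /sqnorm /=.
  by apply/andP; split; lra.
apply: (@le_lt_trans _ _ (M%:E * lebesgueR2 R annulus)%E).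
  rewrite -integral_cst//; apply: ge0_le_integral => //.
  - by move=> x _; rewrite lee_fin.
  - by apply: measurable_funTS; exact/measurable_EFinP.
apply: (@le_lt_trans _ _ (M%:E * lebesgueR2 R B)%E).
  apply: lee_wpmul2l; first by rewrite lee_fin.
  apply: le_measure; rewrite ?inE//; last exact: annulus_sub.
  exact: measurable_rect.
by rewrite lebesgueR2_rect -?EFinM ?ltry//; lra.
Qed.

(** For negative [p] the integrand has no bound on the annulus. It is integrated over the enclosing
    square instead, where Tonelli gives the side length 6 times a one-dimensional integral. *)
Lemma annulus_integral_Re_lty (p : R) : -1 < p ->
  (\int[lebesgueR2 R]_(c in annulus) (`|c.1 : R| `^ p)%:E < +oo)%E.
Proof.
move=> p1; have mA := measurable_annulus.
pose I : set (measurableTypeR R) := `[- (3:R), 3]%classic.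
have mI : measurable I by exact: measurable_itv.
pose f (c : R2) := (`|c.1 : R| `^ p)%:E.
have f0 c : (0 <= f c)%E by rewrite lee_fin powR_ge0.
have mf : measurable_fun [set: R2] f.
  exact: (measurableT_comp (@measurable_norm_powR R p setT)).
apply: (@le_lt_trans _ _ (\int[lebesgueR2 R]_(c in I `*` I) f c)%E).
  apply: ge0_subset_integral => //; last exact: annulus_sub.
  - exact: measurableX.
  - exact: measurable_funTS.
rewrite integral_mkcond /lebesgueR2 /= /sf_product.
rewrite (fubini_tonelli1 (f \_ (I `*` I))); last 2 first.
- by apply/(measurable_restrictT _ (measurableX mI mI)); exact: measurable_funTS.
- by move=> x; exact: erestrict_ge0.
rewrite (eq_integral
  ((fun x : measurableTypeR R => 6%:E * (`|x : R| `^ p)%:E) \_ I)%E); last first.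
  move=> x _; rewrite /fubini_F patchE; case: ifPn => xI.
    transitivity (\int[lambda]_(y in I) (cst (f (x, x)) y))%E.
      rewrite [RHS]integral_mkcond; apply: eq_integral => y _.
      by rewrite !patchE in_setX/= xI.
    have I6 : lambda I = 6%:E.
      rewrite lebesgue_measure_itv/= lte_fin ifT; last lra.
      by rewrite -EFinB; congr EFin; lra.
    by rewrite integral_cst//= I6 muleC.
  by apply: integral0_eq => y _; rewrite patchE in_setX /= (negbTE xI).
rewrite -integral_mkcond ge0_integralZl//; last exact: measurable_norm_powR.
by rewrite lte_mul_pinfty// integral_norm_powR_lty.
Qed.

(* Power sums replace a case distinction on the sign of [p]. *)
Lemma powR_bounds (p m M x : R) : 0 < m -> m <= x -> x <= M ->
  (m `^ (- p) + M `^ (- p))^-1 <= x `^ p <= m `^ p + M `^ p.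
Proof.
move=> m0 mx xM; have x0 := lt_le_trans m0 mx; have M0 := lt_le_trans x0 xM.
have up (q : R) : x `^ q <= m `^ q + M `^ q.
  have [q0|q0] := leP 0 q.
    by rewrite ler_wpDl ?powR_ge0// ge0_ler_powR// nnegrE ltW.
  rewrite ler_wpDr ?powR_ge0// -[q]opprK powRN [leRHS]powRN.
  by rewrite lef_pV2 ?posrE ?powR_gt0// ge0_ler_powR// ?nnegrE ?oppr_ge0 ltW.
rewrite up andbT -[p in leRHS]opprK [leRHS]powRN lef_pV2 ?posrE ?powR_gt0//.
by rewrite addr_gt0// powR_gt0.
Qed.

End annulus.

(** * Support functions of planar convex bodies *)

Section convex_body.
Variables (R : realType) (C : set R[i]^o).
Local Notation R2 := (measurableTypeR R * measurableTypeR R)%type.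

Lemma continuous_Re : continuous (@complex.Re R : R[i]^o -> R).
Proof.
move=> x A /= /nbhs_ballP[e /= e0 eA]; apply/nbhs_ballP.
exists e%:C => /=; first by rewrite ltcR.
move=> y; rewrite -ball_normE /= => xy; apply: eA.
rewrite -ball_normE /= -ltcR.
by apply: le_lt_trans xy; have := normc_ge_Re (x - y); case: (x) (y) => [? ?] [? ?].
Qed.

Lemma continuous_Im : continuous (@complex.Im R : R[i]^o -> R).
Proof.
move=> x A /= /nbhs_ballP[e /= e0 eA]; apply/nbhs_ballP.
exists e%:C => /=; first by rewrite ltcR.
move=> y; rewrite -ball_normE /= => xy; apply: eA.
rewrite -ball_normE /= -ltcR.
apply: le_lt_trans xy; rewrite normc_def lecR -sqrtr_sqr.
by case: (x) (y) => [? ?] [? ?] /=; rewrite ler_wsqrtr// lerDr sqr_ge0.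
Qed.

Lemma compact_coord_bounded : compact C -> exists2 M : R, 0 < M &
  forall c, C c -> `|complex.Re c| <= M /\ `|complex.Im c| <= M.
Proof.
move=> cC.
have bnd (f : R[i]^o -> R) : continuous f -> exists M, forall c, C c -> `|f c| <= M.
  move=> cf; have : compact (f @` C).
    by apply: continuous_compact => //; exact: continuous_subspaceT.
  move=> /compact_bounded[M [_ MP]]; exists (M + 1) => c Cc.
  by apply: (MP (M + 1)); [rewrite ltrDl|exists c].
have [M1 M1P] := bnd _ continuous_Re; have [M2 M2P] := bnd _ continuous_Im.
exists (`|M1| + `|M2| + 1).
  by rewrite ltr_wpDl// addr_ge0.
move=> c Cc; have := M1P c Cc; have := M2P c Cc.
have := ler_norm M1; have := ler_norm M2; have := normr_ge0 M1; have := normr_ge0 M2.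
by move=> *; split; lra.
Qed.

Lemma interior_coord : interior C 0 -> exists2 s : R, 0 < s &
  forall a b : R, `|a| <= 3 -> `|b| <= 3 -> C ((s * a) +i* (s * b)).
Proof.
move=> /nbhs_ballP[[e e'] /=]; rewrite ltcE/= => /andP[/eqP -> {e'} e0] eC.
(* The sum of the absolute values of [s * a] and [s * b] is at most [6 * s], which is below
   [7 * s = e]. *)
have [s s0 se] : exists2 s, 0 < s & s * 7 = e.
  by exists (e / 7); [rewrite divr_gt0|rewrite divfK].
exists s => // a b a3 b3; apply: eC; rewrite -ball_normE /= sub0r normrN normc_def ltcR /=.
apply: le_lt_trans (sqrt_sqrD_le _ _) _.
by rewrite !normrM -mulrDr (gtr0_norm s0) -se ltr_pM2l//; lra.
Qed.

Definition planar_support (z : R2) : R :=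
  sup [set complex.Re c * z.1 + complex.Im c * z.2 | c in C].

Hypothesis cC : compact C.
Hypothesis C0 : interior C 0.

Let C_0 : C 0. Proof. exact: interior_subset. Qed.

Lemma planar_support_has_sup z :
  has_sup [set complex.Re c * z.1 + complex.Im c * z.2 | c in C].
Proof.
split; first by exists (complex.Re 0 * z.1 + complex.Im 0 * z.2); exists 0.
have [M M0 MP] := compact_coord_bounded cC.
exists (M * `|z.1 : R| + M * `|z.2 : R|) => _ [c /MP[c1 c2] <-].
by apply: lerD; apply: le_trans (ler_norm _) _; rewrite normrM ler_wpM2r.
Qed.

Lemma planar_support_ge c z : C c ->
  complex.Re c * z.1 + complex.Im c * z.2 <= planar_support z.
Proof.
by move=> Cc; apply: (sup_ubound (planar_support_has_sup z).2); exists c.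
Qed.

Lemma planar_support_ge0 z : 0 <= planar_support z.
Proof. by have := planar_support_ge z C_0; rewrite /= !mul0r addr0. Qed.

Lemma planar_support_smul r z : 0 <= r ->
  planar_support (smul r z) = r * planar_support z.
Proof.
have le s w : 0 < s -> planar_support (smul s w) <= s * planar_support w.
  move=> s0; apply: ge_sup; first exact: (planar_support_has_sup _).1.
  move=> _ [c Cc <-]; have := planar_support_ge w Cc.
  by rewrite -(ler_pM2l s0); apply: le_trans; rewrite /=; lra.
rewrite le_eqVlt => /predU1P[<-|r0].
  apply/eqP; rewrite eq_le mul0r planar_support_ge0 andbT.
  apply: ge_sup; first exact: (planar_support_has_sup _).1.
  by move=> _ [c _ <-]; rewrite /= !mul0r !mulr0 addr0.
(* The reverse inequality is [le] for the factor [r^-1] at the point [smul r z]. *)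
apply/eqP; rewrite eq_le le//= -ler_pdivlMl//.
have := le r^-1 (smul r z); rewrite invr_gt0 => /(_ r0).
by rewrite {1}/smul/= !mulrA mulVf ?gt_eqF// !mul1r; case: z.
Qed.

(** A supremum of continuous functions is lower semicontinuous: its superlevel sets are open, hence
    measurable. *)
Lemma measurable_planar_support : measurable_fun setT planar_support.
Proof.
move=> mD; apply: (measurability _ (RGenOInfty.measurableE R)) => //.
move=> _ [_ [a ->] <-]; rewrite setTI preimage_itvoy.
have [M M0 MP] := compact_coord_bounded cC.
apply: measurable_open2 => z /= /(sup_gt (planar_support_has_sup z).1)[_ [c Cc <-]].
set s := _ + _ => as_.
(* Within this radius each of the two terms at the fixed point [c] moves by less than [(s - a) / 2],
   so the value stays above [a]. *)
exists ((s - a) / (2 * M)); first by rewrite divr_gt0 ?mulr_gt0// subr_gt0.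
move=> w [w1 w2]; apply: lt_le_trans (planar_support_ge w Cc).
have [c1 c2] := MP c Cc.
have d1 : `|complex.Re c * (w.1 - z.1 : R)| < M * ((s - a) / (2 * M)).
  by rewrite normrM (le_lt_trans (ler_wpM2r _ c1))// ltr_pM2l.
have d2 : `|complex.Im c * (w.2 - z.2 : R)| < M * ((s - a) / (2 * M)).
  by rewrite normrM (le_lt_trans (ler_wpM2r _ c2))// ltr_pM2l.
have eM : M * ((s - a) / (2 * M)) = (s - a) / 2 by field; rewrite gt_eqF.
move: d1 d2; rewrite eM !ltr_norml => /andP[d1 _] /andP[d2 _].
rewrite /s in as_ d1 d2 *; lra.
Qed.

(** Below, [C] contains the multiple of [z] by a fixed [s > 0], so the support function is at least
    [s * sqnorm z]. Above, the coordinates of [C] are bounded by [M] and those of [z] by 3. *)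
Lemma planar_support_annulus : exists m M : R, 0 < m /\
  forall z, annulus z -> m <= planar_support z <= M.
Proof.
have [M M0 MP] := compact_coord_bounded cC; have [s s0 sP] := interior_coord C0.
exists s, (6 * M); split => // z Az; have [] := annulus_sub Az.
rewrite /= !in_itv/= -!ler_norml => z1 z2; apply/andP; split.
  apply: le_trans (planar_support_ge z (sP _ _ z1 z2)).
  move: Az; rewrite /annulus /sqnorm /= => /andP[h _].
  by rewrite -!mulrA -mulrDr -!expr2 ler_peMr// ltW.
apply: ge_sup; first exact: (planar_support_has_sup _).1.
move=> _ [c /MP[c1 c2] <-].
apply: le_trans (ler_norm _) _; apply: le_trans (ler_normD _ _) _.
rewrite !normrM (_ : 6 * M = M * 3 + M * 3); last ring.
by apply: lerD; apply: ler_pM.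
Qed.

End convex_body.

(** * Intersection bodies of circle-invariant sets *)

Section intersection_bodies.
Variable R : realType.
Local Notation R2 := (measurableTypeR R * measurableTypeR R)%type.

(* The Hermitian product of [of_coords t] and [u], as a pair of reals. *)
Definition hermitian n (u : Cspace R n) (t : n.-tuple R2) : R2 :=
  (\sum_(j < n) ((tnth t j).1 * complex.Re (u 0 j) + (tnth t j).2 * complex.Im (u 0 j)),
   \sum_(j < n) ((tnth t j).2 * complex.Re (u 0 j) - (tnth t j).1 * complex.Im (u 0 j))).

Lemma measurable_hermitian n (u : Cspace R n) : measurable_fun setT (hermitian u).
Proof.
have m1 j : measurable_fun setT (fun t : n.-tuple R2 => (tnth t j).1 : R).
  exact: (measurableT_comp measurable_fst (measurable_tnth j)).
have m2 j : measurable_fun setT (fun t : n.-tuple R2 => (tnth t j).2 : R).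
  exact: (measurableT_comp measurable_snd (measurable_tnth j)).
apply/measurable_fun_pairP; split; apply: measurable_sum => j.
  by apply: measurable_funD; apply: measurable_funM.
by apply: measurable_funB; apply: measurable_funM.
Qed.

Lemma hermitian_cmul n (u : Cspace R n) w (t : n.-tuple R2) :
  hermitian u (map_tuple (cmul w) t) = cmul w (hermitian u t).
Proof.
rewrite /hermitian /cmul /=; congr pair; rewrite !mulr_sumr.
  rewrite -sumrB; apply: eq_bigr => j _; rewrite tnth_map /=; ring.
rewrite -big_split; apply: eq_bigr => j _; rewrite tnth_map /=; ring.
Qed.

(** The supremum over [c] in [C] gives the support function of the body [Cu]; the case [c = 1] gives
    the real inner product. *)
Lemma dotR_hermitian n (u : Cspace R n) (c : R[i]) t :
  dotR (of_coords t) (c *: u) =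
  complex.Re c * (hermitian u t).1 + complex.Im c * (hermitian u t).2.
Proof.
rewrite /dotR /hermitian /= !mulr_sumr -big_split; apply: eq_bigr => j _.
rewrite !mxE /=; case: (u 0 j) c => [x y] [a b] /=; ring.
Qed.

Lemma of_coords_cmul n (w : R2) (t : n.-tuple R2) :
  of_coords (map_tuple (cmul w) t) = (w.1 +i* w.2) *: of_coords t.
Proof. by apply/rowP => j; rewrite !mxE tnth_map. Qed.

(** Multiplying all coordinates by a unit [w] preserves Lebesgue measure and [K], and multiplies the
    Hermitian product by [w]. *)
Lemma equivariant_hermitian n (K : set (Cspace R n)) u :
  closed K -> circle_invariant K ->
  equivariant (lebesgueC R n) (@of_coords R n @^-1` K) (hermitian u).
Proof.
move=> cK invK; split; [exact: measurable_of_coords|exact: measurable_hermitian|move=> w w1].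
exists (map_tuple (cmul w)); first exact/preserves_tuple/preserves_rotation.
split; last exact: hermitian_cmul.
have nw : `|w.1 +i* w.2| = 1 :> R[i] by rewrite normc_def /= -/(sqnorm w) w1 sqrtr1.
have w0 : w.1 +i* w.2 != 0 by rewrite -normr_eq0 nw oner_eq0.
apply/seteqP; split => t; rewrite /= of_coords_cmul => Kt.
  (* This inclusion uses the invariance of [K] under the inverse of [w]. *)
  rewrite -(invK (w.1 +i* w.2)^-1) ?normfV ?nw ?invr1//.
  by exists ((w.1 +i* w.2) *: of_coords t) => //; rewrite scalerA mulVf// scale1r.
by rewrite -(invK _ nw); exists (of_coords t).
Qed.

Lemma support_fun_hermitian n (C : set R[i]^o) (u : Cspace R n) t :
  support_fun [set c *: u | c in C] (of_coords t) =
  planar_support C (hermitian u t).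
Proof.
rewrite /support_fun /planar_support image_comp; congr sup.
by apply: eq_imagel => c _; exact: dotR_hermitian.
Qed.

Lemma radial_body_scale n (rho1 rho2 : Cspace R n -> R) (d : R) : 0 < d ->
  (forall u, rho1 u = d * rho2 u) ->
  radial_body rho1 = dilate d (radial_body rho2).
Proof.
move=> d0 rhoE; apply/seteqP; split => x.
  move=> [u [l [u1 /andP[l0 lr] ->]]]; exists ((d^-1 * l)%:C *: u).
    exists u, (d^-1 * l); split => //.
    by rewrite mulr_ge0 ?invr_ge0 ?(ltW d0)//= ler_pdivrMl// -rhoE.
  by rewrite scalerA -rmorphM/= mulrA divff ?gt_eqF// mul1r.
move=> [_ [u [l [u1 /andP[l0 lr] ->]]] <-]; exists u, (d * l); split => //.
  by rewrite rhoE ler_pM2l// lr mulr_ge0// ltW.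
by rewrite scalerA -rmorphM.
Qed.

(** The constant is the ratio of the two annulus integrals. It is chosen before the measure space,
    so one [k] serves all dimensions, all [K] and all [u]. *)
Lemma integral_homogeneous_ratio (p : R) (g1 g2 : R2 -> R) :
  measurable_fun setT g1 -> measurable_fun setT g2 ->
  (forall z, 0 <= g1 z) -> (forall z, 0 <= g2 z) ->
  homogeneous p g1 -> homogeneous p g2 ->
  (0 < \int[lebesgueR2 R]_(c in @annulus R) (g1 c)%:E < +oo)%E ->
  (0 < \int[lebesgueR2 R]_(c in @annulus R) (g2 c)%:E < +oo)%E ->
  exists2 k : R, 0 < k & forall d (T : measurableType d)
    (mu : {sigma_finite_measure set T -> \bar R}) A (z : T -> R2),
    equivariant mu A z ->
    (\int[mu]_(x in A) (g1 (z x))%:E = k%:E * \int[mu]_(x in A) (g2 (z x))%:E)%E.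
Proof.
move=> mg1 mg2 g10 g20 hg1 hg2 /andP[G10 G1y] /andP[G20 G2y].
have mmod : measurable_fun setT (fun z => modulus z `^ p).
  apply: (@measurableT_comp _ _ _ _ _ _ (@powR R ^~ p) _ (@modulus R)) => //.
  exact: measurable_modulus.
have mod_annulus z : annulus z -> 1 <= modulus z <= Num.sqrt 5.
  by move=> /andP[h1 h5]; rewrite -{1}sqrtr1 !ler_wsqrtr.
have Mpos : (0 < \int[lebesgueR2 R]_(c in @annulus R) (modulus c `^ p)%:E)%E.
  apply: (@annulus_integral_gt0 R _ (1 `^ (- p) + Num.sqrt 5 `^ (- p))^-1) => //.
  - by move=> z; exact: powR_ge0.
  - move=> z _ /mod_annulus/andP[h1 h2].
    by have /andP[] := powR_bounds p ltr01 h1 h2.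
have Mfin : (\int[lebesgueR2 R]_(c in @annulus R) (modulus c `^ p)%:E < +oo)%E.
  apply: (@annulus_integral_lty R _ (1 `^ p + Num.sqrt 5 `^ p)) => //.
  - by move=> z; exact: powR_ge0.
  - move=> z /mod_annulus/andP[h1 h2].
    by have /andP[] := powR_bounds p ltr01 h1 h2.
have swap (g : R2 -> R) : measurable_fun setT g -> (forall z, 0 <= g z) -> homogeneous p g ->
    forall d (T : measurableType d) (mu : {sigma_finite_measure set T -> \bar R})
      A (z : T -> R2), equivariant mu A z ->
    ((\int[lebesgueR2 R]_(c in @annulus R) (modulus c `^ p)%:E) *
       \int[mu]_(x in A) (g (z x))%:E =
     (\int[lebesgueR2 R]_(c in @annulus R) (g c)%:E) *
       \int[mu]_(x in A) (modulus (z x) `^ p)%:E)%E.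
  move=> mg g0 hg d T mu A z e.
  exact: (integral_homogeneous_swap (@equivariant_annulus R) e mg g0 hg).
move: G10 G1y G20 G2y Mpos Mfin swap.
set G1 := (\int[_]_(c in _) (g1 c)%:E)%E.
set G2 := (\int[_]_(c in _) (g2 c)%:E)%E.
set M := (\int[_]_(c in _) (_ `^ p)%:E)%E => G10 G1y G20 G2y M0 My swap.
have [m m0 mE] : exists2 m : R, 0 < m & M = m%:E.
  by case: M M0 My {swap} => // m m0 _; exists m.
have [a a0 aE] : exists2 m : R, 0 < m & G1 = m%:E.
  by case: G1 G10 G1y {swap} => // m' m'0 _; exists m'.
have [b b0 bE] : exists2 m : R, 0 < m & G2 = m%:E.
  by case: G2 G20 G2y {swap} => // m' m'0 _; exists m'.
(* The two instances of [swap] read [m * I1 = a * J] and [m * I2 = b * J]; [J] is eliminated. Only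
   the positive reals [m] and [b] are divided by, so the argument covers infinite [I1], [I2] and
   [J]. *)
exists (a / b); first by rewrite divr_gt0.
move=> d T mu A z e.
have s1 := swap _ mg1 g10 hg1 _ _ _ _ _ e; have s2 := swap _ mg2 g20 hg2 _ _ _ _ _ e.
move: s1 s2; rewrite -/M -/G1 -/G2 mE aE bE.
set I1 := (\int[_]_(x in _) _)%E; set J := (\int[_]_(x in _) _)%E.
set I2 := (\int[_]_(x in _) _)%E => s1 s2.
have -> : I1 = ((m^-1 * a)%:E * J)%E.
  by rewrite EFinM -muleA -s1 muleA -EFinM mulVf ?gt_eqF// mul1e.
have -> : J = ((b^-1 * m)%:E * I2)%E.
  by rewrite EFinM -muleA s2 muleA -EFinM mulVf ?gt_eqF// mul1e.
rewrite muleA -EFinM; congr (_%:E * _)%E.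
by field; rewrite !gt_eqF.
Qed.

End intersection_bodies.

Unset Implicit Arguments.

Theorem theorem3 (R : realType) (p : R) (C : set R[i]^o)
    (hp : -1 < p) (hp0 : p != 0) (hC : convex_body_0 C) :
  exists2 d : R, 0 < d &
    forall (n : nat) (K : set (Cspace R n)),
      (0 < n)%N -> star_body K -> circle_invariant K ->
      complex_intersection_body C p K = dilate d (intersection_body p K).
Proof.
case: hC => cC _ C0.
have mpow (f : measurableTypeR R * measurableTypeR R -> R) :
    measurable_fun setT f -> measurable_fun setT (fun z => f z `^ p).
  by move=> mf; apply: (@measurableT_comp _ _ _ _ _ _ (@powR R ^~ p) _ f).
pose g1 z := planar_support C z `^ p.
pose g2 (z : measurableTypeR R * measurableTypeR R) := `|z.1 : R| `^ p.
have mg1 : measurable_fun setT g1 by exact: (mpow _ (measurable_planar_support cC C0)).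
have mg2 : measurable_fun setT g2.
  apply: (mpow (fun z => `|z.1|)).
  exact: (measurableT_comp (@normr_measurable R setT) measurable_fst).
have g10 z : 0 <= g1 z by exact: powR_ge0.
have g20 z : 0 <= g2 z by exact: powR_ge0.
have hg1 : homogeneous p g1.
  move=> r z r0; rewrite /g1 planar_support_smul// powRM//.
  exact: planar_support_ge0.
have hg2 : homogeneous p g2.
  by move=> r z r0; rewrite /g2 /= normrM (ger0_norm r0) powRM.
have [m [M [m0 mM]]] := planar_support_annulus cC C0.
have M0 : 0 < M.
  have /mM/andP[h1 h2] : annulus ((1, 0) : measurableTypeR R * measurableTypeR R).
    by rewrite /annulus /sqnorm /=; lra.
  by rewrite (lt_le_trans m0)// (le_trans h1).
have G1 : (0 < \int[lebesgueR2 R]_(c in @annulus R) (g1 c)%:E < +oo)%E.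
  apply/andP; split.
    apply: (@annulus_integral_gt0 R _ (m `^ (- p) + M `^ (- p))^-1) => //.
      by rewrite invr_gt0 addr_gt0// powR_gt0.
    move=> z _ /mM/andP[h1 h2].
    by have /andP[] := powR_bounds p m0 h1 h2.
  apply: (@annulus_integral_lty R _ (m `^ p + M `^ p)) => // z /mM/andP[h1 h2].
  by have /andP[] := powR_bounds p m0 h1 h2.
have G2 : (0 < \int[lebesgueR2 R]_(c in @annulus R) (g2 c)%:E < +oo)%E.
  rewrite annulus_integral_Re_lty// andbT.
  apply: (@annulus_integral_gt0 R _ (1 `^ (- p) + 2 `^ (- p))^-1) => //.
  move=> z /andP[h1 h2] _; rewrite /g2 ger0_norm ?(le_trans _ h1)//.
  by have /andP[] := powR_bounds p ltr01 h1 h2.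
have [k k0 kP] := integral_homogeneous_ratio mg1 mg2 g10 g20 hg1 hg2 G1 G2.
(* The radial functions are the integrals raised to the power [- p^-1], so the ratio [k] of the
   integrals becomes this dilation factor. *)
exists (k `^ (- p^-1)); first exact: powR_gt0.
move=> n K _ [cK _ _ _] invK.
have {}cK : closed K by apply: compact_closed => //; exact: norm_hausdorff.
apply: radial_body_scale; first exact: powR_gt0.
(* If the integrals are infinite, [fine] sends both to [0]. *)
move=> u; rewrite /integralC /Rintegral.
under eq_integral do rewrite support_fun_hermitian.
(* Writing [u] as [1 *: u] exhibits the real inner product as the first coordinate of the Hermitian
   product. *)
under [in RHS]eq_integral do
  rewrite -[X in dotR _ X]scale1r dotR_hermitian /= mul1r mul0r addr0.
rewrite (kP _ _ _ _ _ (equivariant_hermitian u cK invK)).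
rewrite -powRM ?(ltW k0)//; last first.
  by apply: fine_ge0; apply: integral_ge0 => t _; rewrite lee_fin powR_ge0.
congr (_ `^ _).
have : (0 <= \int[lebesgueC R n]_(t in @of_coords R n @^-1` K) (g2 (hermitian u t))%:E)%E.
  by apply: integral_ge0 => t _; rewrite lee_fin.
set I := (\int[_]_(t in _) _)%E; case: I => [r||] //= _.
by rewrite gt0_muley ?lte_fin//= mulr0.
Qed.
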